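(* Fix $n\ge 2$ and a positive integer $m_0$, and let $(\lambda^{(m)})_{m\ge m_0}$ be a sequence with $\lambda^{(m)}\in\mathbb{R}^{mn}$. Set $H^{(m)}=U(m)\,\mathrm{diag}(\lambda^{(m)})\,U(m)^\dagger$, where $U(m)$ is an $mn\times mn$ Haar-distributed unitary. Suppose that the measures $\mu[\lambda^{(m)}]$ all have support in some bounded interval $[-K,K]$, satisfy a uniform bound $|M_r(\mu[\lambda^{(m)}])|<C$ for all $r$ and $m$, and converge weakly to a probability measure $\mu$. Then, as $m\to\infty$, the random $n\times n$ matrix $\pi_2(m^{-1}H^{(m)})$ converges in probability to $M_1(\mu)I_n$, where $I_n$ is the $n\times n$ identity matrix.
   Context: For $mn\times mn$ matrices with rows/columns indexed lexicographically by double indices $ij$ ($1\le i\le m$, $1\le j\le n$), $\pi_2(H)_{j,l}=\sum_{i=1}^mH_{ij,il}$. The empirical spectral measure of $\lambda\in\mathbb{R}^{mn}$ is $\mu[\lambda]=\frac{1}{mn}\sum_{ij}\delta_{\lambda_{ij}}$ (Dirac masses). $M_r(\nu)=\int x^r\,d\nu(x)$. *)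

(* Defs.v *)
From HB Require Import structures.
From mathcomp Require Import all_boot all_order all_algebra.
From mathcomp Require Import all_classical all_reals all_analysis.
From mathcomp.real_closed Require Import complex.
Set Implicit Arguments. Unset Strict Implicit. Unset Printing Implicit Defensive.
Import Order.TTheory GRing.Theory Num.Theory.
Import numFieldNormedType.Exports.
Local Open Scope ring_scope.
Local Open Scope complex_scope.

Lemma pidx_proof (m n : nat) (i : 'I_m) (j : 'I_n) : (i * n + j < m * n)%N.
Proof.
case: i => i Hi; case: j => j Hj /=.
have H1 : (i * n + j < i * n + n)%N by rewrite ltn_add2l.
apply: (leq_trans H1); rewrite -mulSnr; exact: leq_mul.
Qed.
Definition pidx (m n : nat) (i : 'I_m) (j : 'I_n) : 'I_(m * n) :=
  Ordinal (pidx_proof i j).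

(* partial trace over the first factor: pi_2(H)_{j,l} = sum_i H_{ij,il} *)
Definition pi2 {C : nzRingType} (m n : nat) (H : 'M[C]_(m * n)) : 'M[C]_n :=
  \matrix_(j < n, l < n) \sum_(i < m) H (pidx i j) (pidx i l).

Section Cplx.
Variable R : realType.

Definition adj (N : nat) (A : 'M[R[i]]_N) : 'M[R[i]]_N :=
  \matrix_(i < N, j < N) (A j i)^*.

Definition unitary (N : nat) (A : 'M[R[i]]_N) : Prop := A *m adj A = 1%:M.

Definition reim (N : nat) (A : 'M[R[i]]_N) : 'M[R]_N * 'M[R]_N :=
  (map_mx (@complex.Re R) A, map_mx (@complex.Im R) A).

(* integral of f against the empirical spectral measure
   mu[lam] = 1/N sum_k delta_{lam_k}, N = size of lam *)
Definition emp_int (N : nat) (lam : 'rV[R]_N) (f : R -> R) : R :=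
  N%:R^-1 * \sum_(k < N) f (lam 0 k).

Definition emp_moment (N : nat) (lam : 'rV[R]_N) (r : nat) : R :=
  emp_int lam (fun x => x ^+ r).

Definition conj_diag (N : nat) (U : 'M[R[i]]_N) (lam : 'rV[R]_N) : 'M[R[i]]_N :=
  U *m diag_mx (map_mx (fun x : R => x%:C) lam) *m adj U.

(* U : T -> matrices is a Haar-distributed random unitary matrix on (T, P):
   its entries are random variables, it is unitary, and its law is invariant
   under left multiplication by any fixed unitary V (tested on all bounded
   continuous functions of the real/imaginary parts of the entries).
   Left invariance characterises the Haar probability measure on U(N). *)
Definition haar_unitary {d} {T : measurableType d} (P : probability T R)
  (N : nat) (U : T -> 'M[R[i]]_N) : Prop :=
  [/\ (forall i j, measurable_fun setT (fun w => complex.Re (U w i j))),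
      (forall i j, measurable_fun setT (fun w => complex.Im (U w i j))),
      (forall w, unitary (U w)) &
      (forall (V : 'M[R[i]]_N), unitary V ->
        forall f : 'M[R]_N * 'M[R]_N -> R, continuous f ->
        (exists M : R, forall x, `|f x| <= M) ->
        (\int[P]_w (f (reim (U w)))%:E = \int[P]_w (f (reim (V *m U w)))%:E)%E)].
End Cplx.

(* Main.v *)
Require Import Defs.
From HB Require Import structures.
From mathcomp Require Import all_boot all_order all_algebra.
From mathcomp Require Import all_classical all_reals all_analysis.
From mathcomp.real_closed Require Import complex.
From mathcomp Require Import fingroup perm measurable_realfun ring lra.
Import Order.TTheory GRing.Theory Num.Theory.
Import numFieldNormedType.Exports.
Local Open Scope classical_set_scope.
Local Open Scope ring_scope.
Local Open Scope complex_scope.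

(* Write m_L for the mean of lambda and H_0 = H - m_L I, so that pi_2(H/m) is m_L I
   plus (1/m) sum_i (H_0)_{ij,il} in position (j,l). Left invariance of the law of U
   under signed permutation matrices suffices to bound second moments.
   For distinct i, i' the expectation of (H_0)_{ij,il} times the conjugate of
   (H_0)_{i'j,i'l} vanishes if j <> l, by flipping the sign of one row, and is <= 0
   if j = l, since (H_0)_{aa} has the same correlation with every other diagonal
   entry while H_0 has trace 0. As the entries of H_0 are at most 2K in modulus,
   each (1/m) sum_i (H_0)_{ij,il} has second moment O(K^2/m), and Chebyshev's
   inequality gives the claim because m_L tends to M_1(mu). *)

(** * Entries of U diag(lambda) U^* for a unitary U *)

Section Entries.
Context {R : realType}.

Lemma Re_sum (I : Type) (s : seq I) (F : I -> R[i]) :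
  complex.Re (\sum_(i <- s) F i) = \sum_(i <- s) complex.Re (F i).
Proof. by apply: (big_morph (@complex.Re R)) => // -[a b] [c e]. Qed.

Lemma Im_sum (I : Type) (s : seq I) (F : I -> R[i]) :
  complex.Im (\sum_(i <- s) F i) = \sum_(i <- s) complex.Im (F i).
Proof. by apply: (big_morph (@complex.Im R)) => // -[a b] [c e]. Qed.

(* The real part ([c = true]) or imaginary part ([c = false]) of the entry
   (a, b) of U diag(lam) U^*, as a polynomial in X = (Re U, Im U). *)
Definition entry {N : nat} (c : bool) (lam : 'rV[R]_N) (a b : 'I_N)
    (X : 'M[R]_N * 'M[R]_N) : R :=
  \sum_k lam 0 k * (if c then X.1 a k * X.1 b k + X.2 a k * X.2 b k
                    else X.2 a k * X.1 b k - X.1 a k * X.2 b k).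

Lemma conj_diagE {N : nat} (U : 'M[R[i]]_N) (lam : 'rV[R]_N) (a b : 'I_N) :
  conj_diag U lam a b =
    entry true lam a b (reim U) +i* entry false lam a b (reim U).
Proof.
have E k : (U *m diag_mx (map_mx (fun x : R => x%:C) lam)) a k * adj U k b =
    (lam 0 k * (complex.Re (U a k) * complex.Re (U b k)
                + complex.Im (U a k) * complex.Im (U b k))) +i*
    (lam 0 k * (complex.Im (U a k) * complex.Re (U b k)
                - complex.Re (U a k) * complex.Im (U b k))).
  rewrite mul_mx_diag !mxE.
  case: (U a k) => x y; case: (U b k) => z t.
  by simpc; apply/eqP; rewrite eq_complex /=; apply/andP; split; apply/eqP; ring.
rewrite /conj_diag mxE (eq_bigr _ (fun k _ => E k)).
apply/eqP; rewrite eq_complex Re_sum Im_sum /=.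
by apply/andP; split; apply/eqP; apply: eq_bigr => k _; rewrite !mxE.
Qed.

Section Unitary.
Context {N : nat} {U : 'M[R[i]]_N} (hU : unitary U).

(** Conjugation by a unitary fixes t I. Hence subtracting a constant from lambda only shifts the
    real parts of the diagonal entries, which is what makes centring lambda possible. *)
Lemma entry_const (c : bool) (a b : 'I_N) (t : R) :
  entry c (const_mx t) a b (reim U) = (c && (a == b))%:R * t.
Proof.
have := conj_diagE U (const_mx t) a b.
have -> : conj_diag U (const_mx t) = (t%:C)%:M.
  by rewrite /conj_diag map_const_mx diag_const_mx mul_mx_scalar -scalemxAl hU scalemx1.
by rewrite mxE; case: c; case: (a == b) => /= -[e1 e2];
  rewrite -?e1 -?e2 ?mul1r ?mul0r.
Qed.

Lemma entryB_const (c : bool) (lam : 'rV[R]_N) (a b : 'I_N) (t : R) :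
  entry c lam a b (reim U) =
    entry c (lam - const_mx t) a b (reim U) + (c && (a == b))%:R * t.
Proof.
rewrite -entry_const /entry -big_split; apply: eq_bigr => k _ /=.
by rewrite -mulrDl !mxE subrK.
Qed.

(** Term k is at most B times the average of |U_ak|^2 and |U_bk|^2, and the rows of U are unit
    vectors. *)
Lemma entry_bound (c : bool) (lam : 'rV[R]_N) (B : R) (a b : 'I_N) :
  (forall k, `|lam 0 k| <= B) -> `|entry c lam a b (reim U)| <= B.
Proof.
have H (x y z t : R) : `|x * z + y * t| <= (x * x + y * y + (z * z + t * t)) / 2.
  have := sqr_ge0 (x - z); have := sqr_ge0 (x + z).
  have := sqr_ge0 (y - t); have := sqr_ge0 (y + t).
  by rewrite ler_norml !expr2 => *; apply/andP; split; lra.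
move=> hB; apply: le_trans (ler_norm_sum _ _ _) _.
(* The row norms come from [entry_const]: both diagonal entries of U (B I) U^* equal B, so B becomes
   a sum over k that can be compared term by term. *)
have -> : B = (entry true (const_mx B) a a (reim U)
             + entry true (const_mx B) b b (reim U)) / 2.
  by rewrite !entry_const !eqxx /=; lra.
rewrite /entry -big_split /= mulr_suml; apply: ler_sum => k _.
rewrite normrM !mxE -mulrDr -mulrA; apply: ler_pM => //.
case: c; first exact: H.
by rewrite -mulrN; apply: le_trans (H _ _ _ _) _; lra.
Qed.

Lemma entry_trace (lam : 'rV[R]_N) :
  \sum_a entry true lam a a (reim U) = \sum_k lam 0 k.
Proof.
rewrite exchange_big /=; apply: eq_bigr => k _.
rewrite -mulr_sumr -[RHS]mulr1; congr (_ * _).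
(* A right inverse of a square matrix is a left inverse, so the columns of U are unit vectors
   too. *)
have /mulmx1C/matrixP/(_ k k) := hU.
rewrite !mxE eqxx => /(congr1 (@complex.Re R)) /= => <-; rewrite Re_sum.
apply: eq_bigr => a _; rewrite !mxE; case: (U a k) => x y /=; ring.
Qed.

End Unitary.

Lemma entry_im_diag {N : nat} (lam : 'rV[R]_N) a X : entry false lam a a X = 0.
Proof. by apply: big1 => k _ /=; rewrite mulrC [X in _ - X]mulrC subrr mul0r. Qed.

(** Each term is bilinear in the rows a and b, and real and imaginary parts are transformed alike,
    so the scalars factor out. *)
Lemma entry_rows {N : nat} (c : bool) (lam : 'rV[R]_N) (s : 'I_N -> R)
    (f : 'I_N -> 'I_N) (X Y : 'M[R]_N * 'M[R]_N) a b :
  (forall i k, Y.1 i k = s i * X.1 (f i) k) ->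
  (forall i k, Y.2 i k = s i * X.2 (f i) k) ->
  entry c lam a b Y = s a * s b * entry c lam (f a) (f b) X.
Proof.
move=> h1 h2; rewrite /entry mulr_sumr; apply: eq_bigr => k _.
by rewrite !h1 !h2; case: c; ring.
Qed.

Lemma entry_continuous {N : nat} (c : bool) (lam : 'rV[R]_N) a b :
  continuous (entry c lam a b).
Proof.
move=> X; rewrite /entry.
have c1 i j : (fun x : 'M[R]_N * 'M[R]_N => x.1 i j) @ X --> X.1 i j.
  apply: (@cvg_comp _ _ _ fst (fun M : 'M[R]_N => M i j) _ (nbhs X.1)).
    exact: cvg_fst.
  exact: coord_continuous.
have c2 i j : (fun x : 'M[R]_N * 'M[R]_N => x.2 i j) @ X --> X.2 i j.
  apply: (@cvg_comp _ _ _ snd (fun M : 'M[R]_N => M i j) _ (nbhs X.2)).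
    exact: cvg_snd.
  exact: coord_continuous.
apply: cvg_big => [|k _]; first exact: add_continuous.
apply: cvgM; first exact: cvg_cst.
by case: c; [apply: cvgD|apply: cvgB]; apply: cvgM.
Qed.

End Entries.

(** * Signed permutation matrices as unitaries *)

Section UnitaryMatrices.
Context {R : realType} {N : nat}.

Lemma adjM (A B : 'M[R[i]]_N) : adj (A *m B) = adj B *m adj A.
Proof.
apply/matrixP => i j; rewrite !mxE rmorph_sum; apply: eq_bigr => k _ /=.
by rewrite !mxE rmorphM mulrC.
Qed.

Lemma unitaryM (A B : 'M[R[i]]_N) : unitary A -> unitary B -> unitary (A *m B).
Proof.
rewrite /unitary adjM => hA hB.
by rewrite -mulmxA (mulmxA B) hB mul1mx.
Qed.

Lemma real_unitary (V : 'M[R]_N) :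
  V *m V^T = 1%:M -> unitary (map_mx (real_complex R) V).
Proof.
move=> hV; rewrite /unitary.
have -> : adj (map_mx (real_complex R) V) = map_mx (real_complex R) V^T.
  by apply/matrixP => i j; rewrite !mxE conjc_real.
by rewrite -map_mxM hV map_mx1.
Qed.

(** A real V does not mix real and imaginary parts, so a signed permutation acts on both by the row
    operation that [entry_rows] assumes. *)
Lemma reim_realM (V : 'M[R]_N) (A : 'M[R[i]]_N) :
  reim (map_mx (real_complex R) V *m A) = (V *m (reim A).1, V *m (reim A).2).
Proof.
congr pair; apply/matrixP => i j; rewrite !mxE ?Re_sum ?Im_sum;
  apply: eq_bigr => k _; rewrite !mxE; case: (A k j) => x y /=; ring.
Qed.

Definition signed_perm_mx (s : 'rV[R]_N) (p : {perm 'I_N}) : 'M[R]_N :=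
  diag_mx s *m perm_mx p.

Lemma signed_perm_mxP (s : 'rV[R]_N) (p : {perm 'I_N}) :
  (forall i, s 0 i * s 0 i = 1) ->
  signed_perm_mx s p *m (signed_perm_mx s p)^T = 1%:M.
Proof.
move=> hs; rewrite /signed_perm_mx trmx_mul tr_perm_mx tr_diag_mx -mulmxA.
rewrite (mulmxA (perm_mx p)) -perm_mxM mulgV perm_mx1 mul1mx mulmx_diag.
rewrite -diag_const_mx; congr diag_mx; apply/rowP => i.
by rewrite !mxE hs.
Qed.

Lemma signed_perm_mxM (s : 'rV[R]_N) (p : {perm 'I_N}) (A : 'M[R]_N) i k :
  (signed_perm_mx s p *m A) i k = s 0 i * A (p i) k.
Proof. by rewrite /signed_perm_mx -mulmxA mul_diag_mx -row_permE !mxE. Qed.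

End UnitaryMatrices.

(** * Integrals of bounded random variables, Markov's inequality *)

Section BoundedIntegrals.
Context {d : measure_display} {T : measurableType d} {R : realType}.
Variable P : probability T R.

Lemma bounded_measurable_integrable (f : T -> R) (M : R) :
  measurable_fun setT f -> (forall x, `|f x| <= M) ->
  P.-integrable setT (EFin \o f).
Proof.
move=> mf fM; apply: measurable_bounded_integrable => //.
  by rewrite (le_lt_trans (probability_le1 P measurableT))// ltry.
exists M; split; first exact: num_real.
by move=> M' /ltW MM' x _; exact: le_trans (fM x) MM'.
Qed.

Lemma integrable_EFin_sum (I : Type) (s : seq I) (F : I -> T -> R) :
  (forall i, P.-integrable setT (EFin \o F i)) ->
  P.-integrable setT (EFin \o (fun x => \sum_(i <- s) F i x)).
Proof.
move=> iF; rewrite (_ : _ \o _ = (fun x => \sum_(i <- s) (EFin \o F i) x)%E).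
  exact: integrable_sum.
by apply/funext => x /=; rewrite sumEFin.
Qed.

Lemma Rintegral_sum (I : Type) (s : seq I) (F : I -> T -> R) :
  (forall i, P.-integrable setT (EFin \o F i)) ->
  \int[P]_x (\sum_(i <- s) F i x) = \sum_(i <- s) \int[P]_x F i x.
Proof.
move=> iF; elim: s => [|i s IH].
  under eq_Rintegral do rewrite big_nil.
  by rewrite big_nil Rintegral_cst// mul0r.
under eq_Rintegral do rewrite big_cons.
by rewrite big_cons RintegralD// ?IH//; exact: integrable_EFin_sum.
Qed.

Lemma Rintegral_probability_cst (t : R) : \int[P]_(x in setT) t = t.
Proof. by rewrite Rintegral_cst// [X in fine X](@probability_setT _ _ _ P) mulr1. Qed.

(** Markov's inequality: [q] dominates the indicator of A. *)
Lemma prob_le_Rintegral (A : set T) (q : T -> R) :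
  measurable A -> P.-integrable setT (EFin \o q) ->
  (forall w, 0 <= q w) -> (forall w, A w -> 1 <= q w) ->
  (P A <= (\int[P]_w q w)%:E)%E.
Proof.
move=> mA iq q0 qA; rewrite /Rintegral fineK; last exact: integrable_fin_num.
have -> : P A = (\int[P]_w (\1_A w)%:E)%E by rewrite integral_indic// setIT.
apply: ge0_le_integral => //.
- exact/measurable_EFinP.
- by case/integrableP : iq.
- move=> w _; rewrite lee_fin indicE; case: (boolP (w \in A)) => //= wA.
  by apply: qA; exact: set_mem.
Qed.

End BoundedIntegrals.

(** * Truncation of real functions *)

Section Clamp.
Context {R : realType}.

(** For M >= 0 this is the retraction of the line onto [-M, M]; it turns continuous functions into
    bounded continuous ones. *)
Definition clamp (M x : R) : R := Num.min (Num.max x (- M)) M.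

Lemma clamp_continuous (T : topologicalType) (f : T -> R) (M : R) :
  continuous f -> continuous (fun x => clamp M (f x)).
Proof.
move=> cf x.
apply: (@continuous_min R _ (f \max cst (- M)) (cst M)); last exact: cvg_cst.
by apply: (@continuous_max R _ f (cst (- M))); [exact: cf|exact: cvg_cst].
Qed.

(** The bound is [|M|] because for negative M the function is constantly M. *)
Lemma clamp_bounded (M x : R) : `|clamp M x| <= `|M|.
Proof.
rewrite ler_norml /clamp le_min ge_min le_max.
have := ler_norm M; have := ler_norm (- M); rewrite normrN => h1 h2.
by rewrite h2 orbT andbT lerNl; apply/andP; split; [apply/orP; right|]; lra.
Qed.

Lemma clamp_id (M x : R) : - M <= x <= M -> clamp M x = x.
Proof. by move=> /andP[lo hi]; rewrite /clamp max_l// min_l. Qed.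

End Clamp.

(** * Correlations of two entries under the Haar law *)

Section HaarMoments.
Context {d : measure_display} {T : measurableType d} {R : realType}.
Context {P : probability T R} {N : nat} {U : T -> 'M[R[i]]_N}.
Hypothesis hU : haar_unitary P U.

Lemma haar_entry_measurable (c : bool) (lam : 'rV[R]_N) a b :
  measurable_fun setT (fun w => entry c lam a b (reim (U w))).
Proof.
have [mRe mIm _ _] := hU.
have m1 i j : measurable_fun setT (fun w => (reim (U w)).1 i j).
  by under eq_fun do rewrite mxE; exact: mRe.
have m2 i j : measurable_fun setT (fun w => (reim (U w)).2 i j).
  by under eq_fun do rewrite mxE; exact: mIm.
apply: measurable_sum => k; apply: measurable_funM => //.
by case: c; [apply: measurable_funD|apply: measurable_funB];
  apply: measurable_funM.
Qed.

(* The test functions in [haar_unitary] are bounded on all matrices; truncating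
   extends invariance to functions that are bounded on unitary matrices only. *)
Lemma haar_invariant (V : 'M[R[i]]_N) (f : 'M[R]_N * 'M[R]_N -> R) (M : R) :
  unitary V -> continuous f ->
  (forall A, unitary A -> `|f (reim A)| <= M) ->
  \int[P]_w f (reim (U w)) = \int[P]_w f (reim (V *m U w)).
Proof.
move=> hV cf fM; have [_ _ uU inv] := hU.
pose g X := clamp M (f X).
have gE A : unitary A -> g (reim A) = f (reim A).
  by move=> /fM; rewrite ler_norml; exact: clamp_id.
rewrite /Rintegral; congr fine.
transitivity (\int[P]_w (g (reim (U w)))%:E)%E.
  by apply: eq_integral => w _; rewrite gE.
rewrite (inv V hV) //.
- by apply: eq_integral => w _; rewrite gE//; exact: unitaryM.
- exact: clamp_continuous.
- by exists `|M| => X; exact: clamp_bounded.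
Qed.

Section Bounded.
Context {lam : 'rV[R]_N} {B : R}.
Hypothesis hB : forall k, `|lam 0 k| <= B.

Lemma haar_entry_bound (c : bool) a b w : `|entry c lam a b (reim (U w))| <= B.
Proof. by have [_ _ uU _] := hU; exact: entry_bound. Qed.

Lemma haar_entryM_integrable (c : bool) a b a' b' :
  P.-integrable setT (EFin \o (fun w =>
    entry c lam a b (reim (U w)) * entry c lam a' b' (reim (U w)))).
Proof.
apply: (@bounded_measurable_integrable _ _ _ _ _ (B * B)).
  by apply: measurable_funM; exact: haar_entry_measurable.
by move=> w; rewrite normrM ler_pM// haar_entry_bound.
Qed.

(** Invariance replaces U by V U, with V the signed permutation matrix. Row i of V U is s_i times
    row p(i) of U, so four signs come out of the integral. *)
Lemma haar_entryM_signed_perm (s : 'rV[R]_N) (p : {perm 'I_N}) (c : bool)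
    a b a' b' :
  (forall i, s 0 i * s 0 i = 1) ->
  \int[P]_w (entry c lam a b (reim (U w)) * entry c lam a' b' (reim (U w))) =
  s 0 a * s 0 b * (s 0 a' * s 0 b') *
  \int[P]_w (entry c lam (p a) (p b) (reim (U w)) *
             entry c lam (p a') (p b') (reim (U w))).
Proof.
move=> hs; set V := map_mx (real_complex R) (signed_perm_mx s p).
rewrite (@haar_invariant V (fun X => entry c lam a b X * entry c lam a' b' X)
  (B * B)).
- rewrite -RintegralZl//; last exact: haar_entryM_integrable.
  apply: eq_Rintegral => w _.
  rewrite !(@entry_rows _ _ _ _ (s 0) p (reim (U w)) (reim (V *m U w)));
    try by move=> i k; rewrite reim_realM signed_perm_mxM.
  by ring.
- exact/real_unitary/signed_perm_mxP.
- by move=> X; apply: cvgM; exact: entry_continuous.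
- by move=> A uA; rewrite normrM ler_pM// entry_bound.
Qed.

(* For [a <> b] flip the sign of row [a] of U. For the diagonal entries h, the
   transposition of [b] and [b'] shows that E[h_aa h_bb] does not depend on
   [b <> a], and the sum over all [b <> a] is - E[h_aa^2] as the trace is 0. *)
Lemma haar_entryM_le0 (c : bool) a b a' b' :
  \sum_k lam 0 k = 0 -> a != a' -> a != b' -> (a == b) = (a' == b') ->
  \int[P]_w (entry c lam a b (reim (U w)) * entry c lam a' b' (reim (U w))) <= 0.
Proof.
move=> tr0 aa' ab'; have [<-{b}/esym/eqP<-{b' ab'}|ab _] := eqVneq a b; last first.
  have := @haar_entryM_signed_perm (\row_i (if i == a then -1 else 1)) 1%g
    c a b a' b'.
  rewrite !perm1 !mxE eqxx -!(eq_sym a) (negPf ab) (negPf aa') (negPf ab').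
  have hs i : ((\row_i0 (if i0 == a then -1 else 1)) : 'rV[R]_N) 0 i *
      ((\row_i0 (if i0 == a then -1 else 1)) : 'rV[R]_N) 0 i = 1.
    by rewrite !mxE; case: ifP => _; rewrite ?mulrNN mulr1.
  by move=> /(_ hs); lra.
(* Diagonal entries of a Hermitian matrix are real, so for imaginary parts the integrand is 0. *)
case: c; last first.
  under eq_Rintegral do rewrite entry_im_diag mul0r.
  by rewrite Rintegral_probability_cst.
pose I b := \int[P]_w (entry true lam a a (reim (U w)) *
                       entry true lam b b (reim (U w))).
have Ieq b : b != a -> I b = I a'.
  move=> ba; rewrite /I (@haar_entryM_signed_perm (const_mx 1) (tperm b a')).
    by rewrite !mxE !mul1r tpermL tpermD// eq_sym.
  by move=> i; rewrite !mxE mul1r.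
have Ia0 : 0 <= I a by apply: Rintegral_ge0 => w _; exact: sqr_ge0.
have Isum : \sum_b I b = 0.
  rewrite -Rintegral_sum; last by move=> b; exact: haar_entryM_integrable.
  under eq_Rintegral => w _.
    rewrite -mulr_sumr entry_trace ?tr0 ?mulr0; last by have [] := hU.
    over.
  by rewrite Rintegral_probability_cst.
have : \sum_(b | b != a) I b <= 0.
  by move: Isum; rewrite (bigD1 a) //= => /eqP; rewrite addrC addr_eq0 => /eqP ->;
    rewrite oppr_le0.
(* The sum is a multiple of [I a'] by the number of b different from a, which is positive since a'
   is one of them. *)
rewrite (eq_bigr (fun=> I a')) // sumr_const pmulrn_lle0 //.
by apply/card_gt0P; exists a'; rewrite unfold_in eq_sym.
Qed.

End Bounded.
End HaarMoments.

(** * Second moments of the partial trace, Chebyshev's inequality *)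

Section PartialTrace.
Context {d : measure_display} {T : measurableType d} {R : realType}.
Context {P : probability T R} {m n : nat} {U : T -> 'M[R[i]]_(m * n)}.
Hypothesis hU : haar_unitary P U.

Lemma pidx_inj (i i' : 'I_m) (j l : 'I_n) :
  pidx i j = pidx i' l -> i = i' /\ j = l.
Proof.
move=> /(congr1 val) /= e.
have n0 : (0 < n)%N by apply: leq_trans (ltn_ord j).
have ei : i = i' :> nat.
  have := congr1 (divn^~ n) e.
  by rewrite !divnMDl// !divn_small// !addn0.
split; apply: val_inj => //=.
by move: e; rewrite ei => /addnI.
Qed.

Definition block_sum (c : bool) (lam : 'rV[R]_(m * n)) (j l : 'I_n)
    (A : 'M[R[i]]_(m * n)) : R :=
  \sum_(i < m) entry c lam (pidx i j) (pidx i l) (reim A).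

Lemma pi2_conj_diag (lam : 'rV[R]_(m * n)) (A : 'M[R[i]]_(m * n)) j l :
  pi2 ((m%:R)^-1 *: conj_diag A lam) j l =
    (m%:R^-1 * block_sum true lam j l A) +i*
    (m%:R^-1 * block_sum false lam j l A).
Proof.
have -> : (m%:R)^-1 = (m%:R^-1 : R)%:C by rewrite fmorphV rmorph_nat.
rewrite mxE; apply/eqP; rewrite eq_complex Re_sum Im_sum /=.
apply/andP; split; apply/eqP; rewrite mulr_sumr; apply: eq_bigr => i _;
  by rewrite mxE conj_diagE /= mul0r ?subr0 ?addr0.
Qed.

(** The m shifts by t on the diagonal cancel the factor 1/m, so centring lambda at t subtracts t I
    from the normalised partial trace. *)
Lemma block_sumB_const (c : bool) (lam : 'rV[R]_(m * n)) (t : R) j l A :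
  (0 < m)%N -> unitary A ->
  m%:R^-1 * block_sum c lam j l A =
    m%:R^-1 * block_sum c (lam - const_mx t) j l A + (c && (j == l))%:R * t.
Proof.
move=> m0 uA; have mR : m%:R != 0 :> R by rewrite pnatr_eq0 -lt0n.
apply: (mulfI mR); rewrite mulrDr !mulVKf// /block_sum.
under eq_bigr => i _ do rewrite (entryB_const uA _ _ _ _ t).
rewrite big_split /=; congr (_ + _).
under eq_bigr => i _.
  have -> : (pidx i j == pidx i l) = (j == l).
    by apply/eqP/eqP => [/pidx_inj[]|->].
  over.
by rewrite sumr_const card_ord [RHS]mulr_natl.
Qed.

Section Bounded.
Context {lam : 'rV[R]_(m * n)} {B : R}.
Hypothesis hB : forall k, `|lam 0 k| <= B.

Lemma haar_block_sum_sqr_integrable (c : bool) j l :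
  P.-integrable setT (EFin \o (fun w => block_sum c lam j l (U w) ^+ 2)).
Proof.
under [X in _ \o X]eq_fun do rewrite expr2 /block_sum mulr_suml.
apply: integrable_EFin_sum => i.
under [X in _ \o X]eq_fun do rewrite mulr_sumr.
by apply: integrable_EFin_sum => i'; exact: (haar_entryM_integrable hU hB).
Qed.

(** The square expands into m^2 correlations. The m terms with i = i' are at most B^2 each, and
    those with i <> i' are <= 0 by [haar_entryM_le0], so the bound grows like m and not m^2. *)
Lemma haar_block_sum_sqr (c : bool) j l : \sum_k lam 0 k = 0 ->
  \int[P]_w (block_sum c lam j l (U w) ^+ 2) <= m%:R * B ^+ 2.
Proof.
move=> tr0.
have iM i i' := haar_entryM_integrable hU hB c
  (pidx i j) (pidx i l) (pidx i' j) (pidx i' l).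
under eq_Rintegral do rewrite expr2 {1}/block_sum mulr_suml.
rewrite Rintegral_sum; last first.
  move=> i; under [X in _ \o X]eq_fun do rewrite /block_sum mulr_sumr.
  exact: integrable_EFin_sum.
have -> : m%:R * B ^+ 2 = \sum_(i < m) B ^+ 2.
  by rewrite sumr_const card_ord mulr_natl.
apply: ler_sum => i _.
under eq_Rintegral do rewrite /block_sum mulr_sumr.
rewrite Rintegral_sum// (bigD1 i)//= -[leRHS]addr0; apply: lerD; last first.
  apply: sumr_le0 => i' i'i; apply: (haar_entryM_le0 hU hB) => //.
  - by apply: contra_neq i'i => /pidx_inj[->].
  - by apply: contra_neq i'i => /pidx_inj[->].
  - by apply/eqP/eqP => /pidx_inj[_ ->].
have -> : B ^+ 2 = \int[P]_(w in setT) (B ^+ 2).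
  by rewrite Rintegral_probability_cst.
apply: le_Rintegral => //.
  exact: (@bounded_measurable_integrable _ _ _ _ _ `|B ^+ 2|).
move=> w _; rewrite -expr2 -real_normK ?num_real//.
have h := haar_entry_bound hU hB c (pidx i j) (pidx i l) w.
by rewrite lerXn2r ?nnegrE// (le_trans _ h).
Qed.

End Bounded.

Lemma ler_normc (eps : R) (z : R[i]) : 0 <= eps ->
  (eps%:C <= `|z|) = (eps ^+ 2 <= complex.Re z ^+ 2 + complex.Im z ^+ 2).
Proof.
move=> e0; rewrite normc_def lecR -ler_sqr ?nnegrE ?sqrtr_ge0// sqr_sqrtr//.
by rewrite addr_ge0// sqr_ge0.
Qed.

(** Chebyshev's inequality, summed over the n^2 entries and their two parts. The fluctuation has
    second moment at most m B^2 / m^2, and the bias is the distance from the mean of lambda to t. *)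
Lemma haar_pi2_deviation (lam : 'rV[R]_(m * n)) (B t eps : R) :
  (0 < m)%N -> (0 < n)%N -> 0 < eps ->
  (forall k, `|lam 0 k - emp_moment lam 1| <= B) ->
  (P [set w | exists j l : 'I_n, (eps%:C <=
       `|pi2 ((m%:R)^-1 *: conj_diag (U w) lam) j l - (t%:C)%:M j l|)%R ]
   <= (n%:R * n%:R * 2 * eps ^- 2 *
       (2 * B ^+ 2 * m%:R^-1 + (emp_moment lam 1 - t) ^+ 2))%:E)%E.
Proof.
move=> m0 n0 eps0 hB; set mean := emp_moment lam 1; set e := mean - t.
have mR : 0 < m%:R :> R by rewrite ltr0n.
have nR : 0 < n%:R :> R by rewrite ltr0n.
have [_ _ uU _] := hU.
pose lam0 := lam - const_mx mean.
have hB0 k : `|lam0 0 k| <= B by rewrite !mxE.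
have tr0 : \sum_k lam0 0 k = 0.
  under eq_bigr do rewrite !mxE.
  rewrite big_split /= sumr_const card_ord /mean /emp_moment /emp_int.
  under [in X in _ + X]eq_bigr do rewrite expr1.
  by rewrite mulNrn -[X in _ - X]mulr_natl mulVKf ?subrr// pnatr_eq0 muln_eq0
    negb_or -!lt0n m0 n0.
pose S (x : 'I_n * 'I_n * bool) w := block_sum x.2 lam0 x.1.1 x.1.2 (U w).
have iS x : P.-integrable setT (EFin \o (fun w => S x w ^+ 2)).
  exact: haar_block_sum_sqr_integrable hB0 _ _ _.
pose z j l w := pi2 ((m%:R)^-1 *: conj_diag (U w) lam) j l - (t%:C)%:M j l.
(* Centring leaves the mean on the diagonal, where it combines with - t into e; the imaginary part
   has no bias. *)
have zE j l w : z j l w =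
    (m%:R^-1 * S (j, l, true) w + (j == l)%:R * e) +i*
    (m%:R^-1 * S (j, l, false) w).
  rewrite /z pi2_conj_diag mxE !(block_sumB_const _ lam mean _ _ _ m0 (uU w)) /=.
  rewrite mul0r addr0 -/(S (j, l, true) w) -/(S (j, l, false) w).
  case: (j == l); rewrite ?mulr1n ?mulr0n ?mul1r ?mul0r ?subr0 ?addr0//.
  by apply/eqP; rewrite eq_complex /= addrA subr0 !eqxx.
(* The two terms of [q] at (j, l) together bound |z_jl|^2 / eps^2, since (x + e)^2 <= 2 x^2 + 2 e^2.
   The resulting 2 e^2 is shared between the two parts, hence no factor 2 in b. *)
pose a := 2 * eps ^- 2 * m%:R ^- 2.
pose b := eps ^- 2 * e ^+ 2.
pose q w := \sum_x (a * S x w ^+ 2 + b).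
have iaS x : P.-integrable setT (EFin \o (fun w => a * S x w ^+ 2)).
  exact: (integrableZl measurableT a (iS x)).
have ib : P.-integrable setT (EFin \o (fun _ : T => b)).
  exact: (@bounded_measurable_integrable _ _ _ _ _ `|b|).
have iq1 x : P.-integrable setT (EFin \o (fun w => a * S x w ^+ 2 + b)).
  exact: (integrableD measurableT (iaS x) ib).
have a0 : 0 <= a by rewrite !mulr_ge0// invr_ge0 exprn_ge0// ltW.
have b0 : 0 <= b by rewrite mulr_ge0 ?sqr_ge0// invr_ge0 exprn_ge0// ltW.
have q10 x w : 0 <= a * S x w ^+ 2 + b by rewrite addr_ge0// mulr_ge0// sqr_ge0.
apply: (@le_trans _ _ (\int[P]_w q w)%:E).
- apply: prob_le_Rintegral.
  (* The event is a finite union over (j, l) of preimages of [eps^2, +oo[ under the measurable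
     functions |z_jl|^2. *)
  + rewrite (_ : [set w | _] =
      \bigcup_(x in [set: 'I_n * 'I_n]) [set w | eps ^+ 2 <=
        complex.Re (z x.1 x.2 w) ^+ 2 + complex.Im (z x.1 x.2 w) ^+ 2])%classic.
      apply: fin_bigcup_measurable => // x _.
      have mS c : measurable_fun setT (fun w => S (x, c) w).
        rewrite /S /block_sum /=; apply: measurable_sum => i.
        exact: (haar_entry_measurable hU).
      rewrite -[X in measurable X]setTI.
      have mz : measurable_fun setT (fun w =>
          complex.Re (z x.1 x.2 w) ^+ 2 + complex.Im (z x.1 x.2 w) ^+ 2).
        under eq_fun do rewrite zE /= -surjective_pairing.
        apply: measurable_funD; apply: measurable_funX => //.
          by apply: measurable_funD => //; apply: measurable_funM.
        by apply: measurable_funM.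
      have := mz measurableT _ (measurable_itv `[eps ^+ 2, +oo[).
      congr (measurable (_ `&` _)); apply/seteqP; split => w /=;
        by rewrite in_itv /= andbT.
    apply/seteqP; split => w /=.
      by move=> [j [l]]; rewrite (ler_normc _ _ (ltW eps0)) => h; exists (j, l).
    by move=> [[j l] _ /= h]; exists j, l; rewrite (ler_normc _ _ (ltW eps0)).
  + exact: integrable_EFin_sum.
  + by move=> w; apply: sumr_ge0.
  + move=> w [j [l]]; rewrite -/(z j l w) (ler_normc _ _ (ltW eps0)) zE /= => h.
    apply: (@le_trans _ _ ((a * S (j, l, true) w ^+ 2 + b) +
                           (a * S (j, l, false) w ^+ 2 + b))).
      rewrite /a /b; set x := S _ w in h *; set y := S _ w in h *.
      have -> : 2 / eps ^+ 2 / m%:R ^+ 2 * x ^+ 2 + eps ^- 2 * e ^+ 2 +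
          (2 / eps ^+ 2 / m%:R ^+ 2 * y ^+ 2 + eps ^- 2 * e ^+ 2) =
        (2 * (m%:R^-1 * x) ^+ 2 + 2 * (m%:R^-1 * y) ^+ 2 + 2 * e ^+ 2) / eps ^+ 2.
        by field; rewrite !gt_eqF.
      rewrite ler_pdivlMr ?exprn_gt0// mul1r (le_trans h)//.
      have := sqr_ge0 (m%:R^-1 * y); have := sqr_ge0 (m%:R^-1 * x).
      have := sqr_ge0 (m%:R^-1 * x - e).
      by case: (j == l) => /=; nra.
    (* All other terms of [q] are nonnegative. *)
    rewrite /q (bigD1 (j, l, true))// (bigD1 (j, l, false)) /=; last first.
      by rewrite xpair_eqE andbF.
    by rewrite [leRHS]addrA lerDl; apply: sumr_ge0.
- rewrite lee_fin Rintegral_sum//.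
  have -> : n%:R * n%:R * 2 * eps ^- 2 * (2 * B ^+ 2 * m%:R^-1 + e ^+ 2) =
      \sum_(x : 'I_n * 'I_n * bool) (a * (m%:R * B ^+ 2) + b).
    rewrite sumr_const !card_prod card_ord card_bool -[RHS]mulr_natl !natrM /a /b.
    by field; rewrite !gt_eqF.
  apply: ler_sum => x _; rewrite RintegralD// RintegralZl//.
  rewrite Rintegral_probability_cst lerD2r ler_wpM2l//.
  exact: (haar_block_sum_sqr hB0).
Qed.

End PartialTrace.

(** * Convergence of the spectral mean to the mean of mu *)

Section Mean.
Context {R : realType}.

(* [min 1 |x - clamp K x|] is a bounded continuous function vanishing exactly on
   [-K, K]; its integral against mu is 0, so that mu is carried by [-K, K]. *)
Lemma emp_mean_cvg (N : nat -> nat) (lam : forall m, 'rV[R]_(N m))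
    (mu : probability R R) (K : R) (m0 : nat) :
  (forall m, (m0 <= m)%N -> forall k, - K <= lam m 0 k <= K) ->
  (forall f : R -> R, continuous f -> (exists M : R, forall x, `|f x| <= M) ->
     (fun m => (emp_int (lam m) f)%:E) @ \oo --> (\int[mu]_x (f x)%:E)%E) ->
  (fun m => emp_moment (lam m) 1) @ \oo --> fine (\int[mu]_x x%:E)%E.
Proof.
move=> hK hw.
have cc : continuous (clamp K) by apply: (@clamp_continuous R _ id) => x; exact: cvg_id.
have mc : measurable_fun setT (clamp K) by exact: continuous_measurable_fun.
pose g (x : R) := clamp 1 `|x - clamp K x|.
have cg : continuous g.
  apply: clamp_continuous => x.
  by apply: cvg_norm; apply: cvgB; [exact: cvg_id|exact: cc].
have mg : measurable_fun setT g by exact: continuous_measurable_fun.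
have g0 x : 0 <= g x.
  by rewrite /g /clamp le_min ler01 andbT le_max normr_ge0.
(* From m0 on all atoms lie in [-K, K], so only values there affect the empirical integral. *)
have ev (f f' : R -> R) : (forall x, - K <= x <= K -> f x = f' x) ->
    \forall m \near \oo, emp_int (lam m) f = emp_int (lam m) f'.
  move=> ff'; exists m0 => // m /= mm0; rewrite /emp_int; congr (_ * _).
  by apply: eq_bigr => k _; exact/ff'/hK.
have intg : (\int[mu]_x (g x)%:E = 0)%E.
  have bg : exists M : R, forall x, `|g x| <= M.
    by exists `|1| => x; exact: clamp_bounded.
  have h1 := hw g cg bg.
  have h2 : (fun m => (emp_int (lam m) g)%:E) @ \oo --> 0%E.
    apply: (cvg_trans _ (@cvg_cst _ (0%E : \bar R) _ \oo _)).
    apply: near_eq_cvg; near=> m; apply/esym.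
    have -> : emp_int (lam m) g = emp_int (lam m) (cst 0).
      near: m; apply: ev => x xK.
      by rewrite /g (clamp_id _ _ xK) subrr normr0 clamp_id// ler01 lerN10.
    by rewrite /emp_int big1 // mulr0.
  exact: (cvg_unique _ h1 h2).
have int_clamp : (\int[mu]_x x%:E = \int[mu]_x (clamp K x)%:E)%E.
  have /ae_eq_integral_abs : (\int[mu]_x `|(g x)%:E| = 0)%E.
    by rewrite -[RHS]intg; apply: eq_integral => x _; rewrite gee0_abs ?lee_fin.
  have mgE : measurable_fun setT (fun x => (g x)%:E) by exact/measurable_EFinP.
  move=> /(_ measurableT mgE) ae0.
  apply: ae_eq_integral => //; [exact/measurable_EFinP..|].
  apply: filterS ae0 => x /= /(_ I) [gx] _; congr EFin; apply/eqP.
  move: gx; rewrite /g /clamp -subr_eq0 -normr_eq0.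
  have := normr_ge0 (x - Num.min (Num.max x (- K)) K); set y := `|_| => y0.
  rewrite max_l; last by rewrite (le_trans _ y0)// lerN10.
  by rewrite minEle; case: ifP => _ e; [rewrite e|move/eqP: e; rewrite oner_eq0].
(* The identity is unbounded, so weak convergence is applied to [clamp K], which agrees with it on
   [-K, K] and has the same integral against mu. *)
have h := hw _ cc (ex_intro _ `|K| (clamp_bounded K)).
have fin : (\int[mu]_x (clamp K x)%:E)%E \is a fin_num.
  apply: integrable_fin_num => //.
  apply: (@bounded_measurable_integrable _ _ _ mu (clamp K) `|K|) => // x.
  exact: clamp_bounded.
rewrite int_clamp; rewrite -(fineK fin) in h.
apply: cvg_trans (fine_cvg h); apply: near_eq_cvg; near=> m => /=.
rewrite /emp_moment; near: m; apply: ev => x xK.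
by rewrite clamp_id// expr1.
Unshelve. all: by end_near. Qed.

End Mean.

(** * Conclusion: the deviation probability is squeezed to 0 *)

Theorem theorem4p5 (R : realType) (n m0 : nat) (hn : (2 <= n)%N) (hm0 : (0 < m0)%N)
  (lam : forall m : nat, 'rV[R]_(m * n))
  (d : measure_display) (T : measurableType d) (P : probability T R)
  (U : forall m : nat, T -> 'M[R[i]]_(m * n))
  (mu : probability R R) (K C : R) :
  (forall m, (m0 <= m)%N -> haar_unitary P (U m)) ->
  (forall m, (m0 <= m)%N -> forall k, - K <= lam m 0 k <= K) ->
  (forall m r, (m0 <= m)%N -> `|emp_moment (lam m) r| < C) ->
  (forall f : R -> R, continuous f -> (exists M : R, forall x, `|f x| <= M) ->
     (fun m => (emp_int (lam m) f)%:E) @ \oo --> (\int[mu]_x (f x)%:E)%E) ->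
  forall eps : R, 0 < eps ->
    (fun m => P [set w | exists j l : 'I_n,
         eps%:C <= `|pi2 ((m%:R)^-1 *: conj_diag (U m w) (lam m)) j l
                     - ((fine (\int[mu]_x x%:E)%E)%:C)%:M j l| ])
      @ \oo --> 0%E.
Proof.
move=> hU hK _ hw eps eps0.
set t := fine _.
have n0 : (0 < n)%N by apply: leq_trans hn.
have mean_cvg : (fun m => emp_moment (lam m) 1) @ \oo --> t.
  exact: emp_mean_cvg hK hw.
have inv_cvg : (fun m : nat => m%:R^-1 : R) @ \oo --> 0.
  (* The harmonic sequence starts at 1/1, so the index is shifted past m = 0. *)
  by rewrite -cvg_shiftS; exact: cvg_harmonic.
(* Here B = K + K, since an eigenvalue and the mean each have modulus at most K. *)
pose bound m : R := n%:R * n%:R * 2 * eps ^- 2 *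
  (2 * (K + K) ^+ 2 * m%:R^-1 + (emp_moment (lam m) 1 - t) ^+ 2).
have bound_cvg : bound @ \oo --> 0.
  rewrite [X in _ --> X](_ : 0 = n%:R * n%:R * 2 * eps ^- 2 *
    (2 * (K + K) ^+ 2 * 0 + (t - t) * (t - t))); last by ring.
  apply: cvgM; first exact: cvg_cst.
  apply: cvgD; first by apply: cvgM => //; exact: cvg_cst.
  by apply: cvgM; apply: cvgB => //; exact: cvg_cst.
apply: (@squeeze_cvge _ _ _ _ (fun=> 0%E) _ (fun m => (bound m)%:E)).
- exists m0 => // m /= mm0; rewrite measure_ge0 /=.
  have m1 : (0 < m)%N by apply: leq_trans mm0.
  apply: (haar_pi2_deviation (hU m mm0)) => // k.
  have N0 : 0 < (m * n)%:R :> R by rewrite ltr0n muln_gt0 m1.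
  apply: (le_trans (ler_normB _ _)); apply: lerD; first by rewrite ler_norml hK.
  rewrite /emp_moment /emp_int normrM gtr0_norm ?invr_gt0// ler_pdivrMl//.
  apply: (le_trans (ler_norm_sum _ _ _)).
  have -> : (m * n)%:R * K = \sum_(i < m * n) K.
    by rewrite sumr_const card_ord mulr_natl.
  by apply: ler_sum => i _; rewrite expr1 ler_norml hK.
- exact: cvg_cst.
- by apply: cvg_EFin; [exact: nearW|exact: bound_cvg].
Qed.
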